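(* Let $\Omega = \mathbb{R}^2/(2\pi\mathbb{Z})^2$ be the flat two-dimensional torus, let $n\ge2$, $\tau>0$, $\lambda>0$, let $f$ be a given image on $\Omega$, let $\mathcal{S}$ be a set, and let $F_1,\dots,F_n$ be maps assigning to each $\Theta\in\mathcal{S}$ functions $F_i(f,\Theta)\in L^1(\Omega)$. Let $\tilde{\mathcal{B}}$ be the set of measurable $u=(u_1,\dots,u_n):\Omega\to\{0,1\}^n$ with $\sum_{i=1}^n u_i(x)=1$ for all $x$. For $u\in\tilde{\mathcal{B}}$, $\Theta\in\mathcal{S}$ define $$\mathcal{E}^\tau(u,\Theta)=\sum_{i=1}^n\int_\Omega u_i\,F_i(f,\Theta)\,dx+\lambda\sqrt{\tfrac{\pi}{\tau}}\sum_{i=1}^n\sum_{j=1,j\ne i}^n\int_\Omega u_i\,(G_\tau*u_j)\,dx.$$ Let $(u^k,\Theta^k)_{k\ge1}$ be any sequence generated by the following iteration (the multiphase ICTM), starting from $u^1\in\tilde{\mathcal{B}}$: (1) $\Theta^k\in\arg\min_{\Theta\in\mathcal{S}}\sum_{i=1}^n\int_\Omega u_i^k F_i(f,\Theta)\,dx$ (a minimizer is assumed to exist at every step); (2) for $i=1,\dots,n$, $\phi_i^k = F_i(f,\Theta^k) + 2\lambda\sqrt{\tfrac{\pi}{\tau}}\sum_{j=1,j\ne i}^n G_\tau*u_j^k$; (3) for $i=1,\dots,n$, $u_i^{k+1}(x)=1$ if $i=\min\{\arg\min_{\ell\in\{1,\dots,n\}}\phi_\ell^k(x)\}$ and $u_i^{k+1}(x)=0$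 otherwise. Then for every $k\ge1$ and every $\tau>0$, $$\mathcal{E}^\tau(u^{k+1},\Theta^{k+1})\le\mathcal{E}^\tau(u^k,\Theta^k).$$
   Context: $G_\tau$ denotes the heat kernel on the torus $\Omega$, i.e. the $2\pi\mathbb{Z}^2$-periodization $G_\tau(x)=\sum_{m\in\mathbb{Z}^2}\frac{1}{4\pi\tau}\exp\!\big(-\frac{|x+2\pi m|^2}{4\tau}\big)$ of the Gaussian $\frac{1}{4\pi\tau}e^{-|x|^2/(4\tau)}$, and $*$ is convolution on $\Omega$. Each $u_i$ is the characteristic function of the $i$-th segment; $F_i$ are fidelity integrands of a general $n$-phase segmentation energy and $\Theta$ collects all parameters/functions appearing in them. *)

(* Defs.v *)
From HB Require Import structures.
From mathcomp Require Import all_boot all_order all_algebra.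
From mathcomp Require Import all_classical all_reals all_analysis.
Set Implicit Arguments. Unset Strict Implicit. Unset Printing Implicit Defensive.
Import Order.TTheory GRing.Theory Num.Theory.
Import numFieldNormedType.Exports.
Local Open Scope classical_set_scope.
Local Open Scope ring_scope.

Section Torus.
Variable R : realType.

Definition leb2 := ((@lebesgue_measure R) \x (@lebesgue_measure R))%E.

(* The torus Omega = R^2/(2 pi Z)^2 is represented by its fundamental domain
   [0, 2pi) x [0, 2pi) with the Lebesgue measure; functions on Omega are
   functions R*R -> R of which only the values on Omega_D matter. *)
Definition Omega_D : set (R * R) :=
  [set x | (0 <= x.1 < 2 * pi) /\ (0 <= x.2 < 2 * pi)].

Definition tmod (a : R) : R := a - 2 * pi * (Num.floor (a / (2 * pi)))%:~R.
Definition tmod2 (x : R * R) : R * R := (tmod x.1, tmod x.2).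

Definition gauss (tau : R) (x : R * R) : R :=
  (4 * pi * tau)^-1 * expR (- (x.1 ^+ 2 + x.2 ^+ 2) / (4 * tau)).

(* Heat kernel on the torus: (2 pi Z^2)-periodization of the Gaussian. *)
Definition heatG (tau : R) (x : R * R) : R :=
  fine (\esum_(m in [set: int * int])
          (gauss tau (x.1 + 2 * pi * m.1%:~R, x.2 + 2 * pi * m.2%:~R))%:E).

Definition tconv (G v : R * R -> R) (x : R * R) : R :=
  Rintegral leb2 Omega_D (fun y => G (x.1 - y.1, x.2 - y.2) * v (tmod2 y)).

Definition tildeB (n : nat) (u : 'I_n -> R * R -> R) : Prop :=
  (forall i, measurable_fun Omega_D (u i)) /\
  (forall i x, Omega_D x -> u i x = 0 \/ u i x = 1) /\
  (forall x, Omega_D x -> \sum_(i < n) u i x = 1).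

Definition energy (n : nat) (tau lam : R) (Fi : 'I_n -> R * R -> R)
  (u : 'I_n -> R * R -> R) : \bar R :=
  ((\sum_(i < n) \int[leb2]_(x in Omega_D) (u i x * Fi i x)%:E)
   + (lam * Num.sqrt (pi / tau))%:E *
     \sum_(i < n) \sum_(j < n | j != i)
        \int[leb2]_(x in Omega_D) (u i x * tconv (heatG tau) (u j) x)%:E)%E.

Definition fidelity (n : nat) (Fi : 'I_n -> R * R -> R)
  (u : 'I_n -> R * R -> R) : \bar R :=
  (\sum_(i < n) \int[leb2]_(x in Omega_D) (u i x * Fi i x)%:E)%E.

Definition first_argmin (n : nat) (phi : 'I_n -> R * R -> R) (x : R * R)
  (i : 'I_n) : Prop :=
  (forall l : 'I_n, phi i x <= phi l x) /\
  (forall l : 'I_n, (l < i)%N -> phi i x < phi l x).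

End Torus.

(* Main.v *)
Require Import Defs.
From HB Require Import structures.
From mathcomp Require Import all_boot all_order all_algebra.
From mathcomp Require Import all_classical all_reals all_analysis.
From mathcomp Require Import measurable_realfun ring lra.
Import Order.TTheory GRing.Theory Num.Theory.
Import numFieldNormedType.Exports.
Local Open Scope classical_set_scope.
Local Open Scope ring_scope.

(* Write Q(u, v) for the integral of u (G_tau * v).  Since the phases sum to 1,
   the interaction term is Q(1, 1) - sum_i Q(u_i, u_i), which is concave because
   Q is symmetric and positive semidefinite; it therefore lies below its
   linearization at u^k, and the thresholding step minimizes exactly the sum of
   the fidelity and this linearization, pointwise.  Step (1) then only decreases
   the fidelity.

   Positivity of Q: G_tau(x - y) is a product of two one-dimensional theta
   functions theta(s - t) = sum_m g(s - t + 2 pi m).  The Cesaro means of the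
   symmetric partial sums of theta are
     N^-1 sum_(a, b < N) g((s + 2 pi a) - (t + 2 pi b)),
   and g(p - q) = g(p) g(q) exp(p q / (2 tau)) expands by Taylor's formula into
   nonnegative multiples of products phi(p) phi(q).  So G_tau is an iterated
   bounded limit of finite sums of kernels phi(x) phi(y). *)

(** * Positive semidefinite kernels *)

Section PsdKernel.
Context {d : measure_display} {T : measurableType d} {R : realType}.
Variables (mu : {measure set T -> \bar R}) (D : set T).
Hypotheses (mD : measurable D) (finD : (mu D < +oo)%E).

(** Test functions for the kernels: as [D] has finite measure they are integrable, and unlike
    integrable functions they are stable under products. *)
Definition bmeas (f : T -> R) : Prop :=
  measurable_fun D f /\ exists C, forall x, D x -> `|f x| <= C.

Lemma bmeas_integrable f : bmeas f -> mu.-integrable D (EFin \o f).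
Proof.
move=> [mf [C fC]]; apply: measurable_bounded_integrable => //.
exists C; split; first exact: num_real.
by move=> M CM x Dx; exact: le_trans (fC _ Dx) (ltW CM).
Qed.

Lemma bmeasM_integrable f g : bmeas f -> mu.-integrable D (EFin \o g) ->
  mu.-integrable D (EFin \o (fun x => f x * g x)).
Proof.
move=> [mf [C fC]] ig.
apply: (@eq_integrable _ _ _ _ _ mD ((EFin \o f) \* (EFin \o g))%E) => //.
apply: integrableMr => //.
exists C; split; first exact: num_real.
by move=> M CM x Dx; exact: le_trans (fC _ Dx) (ltW CM).
Qed.

Lemma bmeas_cst c : bmeas (fun=> c).
Proof. by split; [exact: measurable_cst|exists `|c|]. Qed.

Lemma bmeasD f g : bmeas f -> bmeas g -> bmeas (fun x => f x + g x).
Proof.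
move=> [mf [C fC]] [mg [E gE]]; split; first exact: measurable_funD.
exists (C + E) => x Dx.
by rewrite (le_trans (ler_normD _ _))// lerD ?fC ?gE.
Qed.

Lemma bmeasM f g : bmeas f -> bmeas g -> bmeas (fun x => f x * g x).
Proof.
move=> [mf [C fC]] [mg [E gE]]; split; first exact: measurable_funM.
by exists (C * E) => x Dx; rewrite normrM ler_pM ?fC ?gE.
Qed.

Lemma bmeasB f g : bmeas f -> bmeas g -> bmeas (fun x => f x - g x).
Proof.
move=> bf bg; have := bmeasD f (fun x => (-1) * g x) bf
  (bmeasM _ _ (bmeas_cst _) bg).
by congr bmeas; apply/funext => x; rewrite mulN1r.
Qed.

Lemma bmeas_sum (I : Type) (r : seq I) (P : pred I) (f : I -> T -> R) :
  (forall i, bmeas (f i)) -> bmeas (fun x => \sum_(i <- r | P i) f i x).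
Proof.
move=> bf; elim: r => [|i r IH].
  by under eq_fun do rewrite big_nil; exact: bmeas_cst.
under eq_fun do rewrite big_cons.
by case: (P i) => //; exact: bmeasD.
Qed.

Lemma Rintegral_sum (I : Type) (r : seq I) (P : pred I) (f : I -> T -> R) :
  (forall i, mu.-integrable D (EFin \o f i)) ->
  \int[mu]_(x in D) (\sum_(i <- r | P i) f i x) =
  \sum_(i <- r | P i) \int[mu]_(x in D) f i x.
Proof.
move=> fi; elim: r => [|i r IH].
  rewrite big_nil; under eq_Rintegral do rewrite big_nil.
  by rewrite Rintegral_cst// mul0r.
rewrite big_cons; under eq_Rintegral do rewrite big_cons.
case: ifP => // _; rewrite RintegralD// ?IH//.
apply: (eq_integrable mD (fun x => \sum_(j <- r | P j) (f j x)%:E)%E).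
  by move=> x _; rewrite /= sumEFin.
by apply: integrable_sum => // j _; exact: fi.
Qed.

(** Dominated convergence with the constant [C] as dominating function, integrable because [D] has
    finite measure. *)
Lemma cvg_Rintegral_bounded (f_ : nat -> T -> R) (f : T -> R) C :
  (forall m, measurable_fun D (f_ m)) ->
  (forall m x, D x -> `|f_ m x| <= C) ->
  (forall x, D x -> f_ m x @[m --> \oo] --> f x) ->
  \int[mu]_(x in D) f_ m x @[m --> \oo] --> \int[mu]_(x in D) f x.
Proof.
move=> mf_ fC cf.
have iC : mu.-integrable D (EFin \o (fun=> C)).
  exact: bmeas_integrable (bmeas_cst _).
have mf : measurable_fun D f by exact: measurable_fun_cvg mf_ cf.
have cfE x : D x -> (f_ m x)%:E @[m --> \oo] --> (f x)%:E.
  by move=> Dx; apply: cvg_EFin; [exact: nearW|exact: cf].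
have [|||||fi _ cvi] := @dominated_convergence _ _ _ mu D mD
  (fun m => EFin \o f_ m) (EFin \o f) (EFin \o fun=> C).
- by move=> m; exact/measurable_EFinP.
- exact/measurable_EFinP.
- exact: aeW.
- by [].
- by apply: aeW => x m Dx; rewrite lee_fin fC.
by apply: fine_cvg; rewrite fineK//; exact: integrable_fin_num.
Qed.

(** For [k x y] $= G_\tau(x-y)$, [kint] is convolution with $G_\tau$ and [kform] is the form Q. *)
Definition kint (k : T -> T -> R) (v : T -> R) (x : T) : R :=
  \int[mu]_(y in D) (k x y * v y).

Definition kform (k : T -> T -> R) (u v : T -> R) : R :=
  \int[mu]_(x in D) (u x * kint k v x).

(* Both symmetry and positivity are asked of the iterated integral only, without
   joint measurability of [k], so that each clause survives bounded pointwise
   limits by dominated convergence and Fubini's theorem is never needed. *)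
Record psd_kernel (k : T -> T -> R) : Prop := PsdKernel {
  psdk_bound : exists C, forall x y, D x -> D y -> `|k x y| <= C ;
  psdk_measurable : forall x, D x -> measurable_fun D (k x) ;
  psdk_kint : forall v, bmeas v -> measurable_fun D (kint k v) ;
  psdk_sym : forall u v, bmeas u -> bmeas v -> kform k u v = kform k v u ;
  psdk_ge0 : forall u, bmeas u -> 0 <= kform k u u }.

(** Supplies the dominating constant for the outer integral when kernels converge; the bound depends
    on the kernel only through [C], hence is uniform along a sequence. *)
Lemma kint_bound (k : T -> T -> R) (v : T -> R) C E : (forall x y, D x -> D y -> `|k x y| <= C) ->
  (forall x, D x -> measurable_fun D (k x)) ->
  measurable_fun D v -> (forall x, D x -> `|v x| <= E) ->
  forall x, D x -> `|kint k v x| <= C * E * fine (mu D).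
Proof.
move=> kC mk mv vE x Dx.
have bkv : bmeas (fun y => k x y * v y).
  by apply: bmeasM; split; [exact: mk|exists C => y; exact: kC|by []|exists E].
apply: le_trans (le_normr_Rintegral _ (bmeas_integrable _ bkv)) _ => //.
rewrite -Rintegral_cst//; apply: le_Rintegral => //.
- by apply: integrable_norm; exact: bmeas_integrable.
- exact: bmeas_integrable (bmeas_cst _).
- by move=> y Dy; rewrite normrM ler_pM// ?kC ?vE.
Qed.

Section OneKernel.
Variables (k : T -> T -> R) (psdk : psd_kernel k).

Lemma psdk_row x : D x -> bmeas (k x).
Proof.
move=> Dx; split; first exact: psdk_measurable.
by have [C kC] := psdk_bound _ psdk; exists C => y; exact: kC.
Qed.

Lemma kint_bmeas v : bmeas v -> bmeas (kint k v).
Proof.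
move=> [mv [E vE]]; split; first by apply: psdk_kint => //; split=> //; exists E.
have [C kC] := psdk_bound _ psdk; exists (C * E * fine (mu D)).
exact: kint_bound kC (psdk_measurable _ psdk) mv vE.
Qed.

Lemma kint_sum (I : Type) (r : seq I) (P : pred I) (v : I -> T -> R) x :
  D x -> (forall i, bmeas (v i)) ->
  kint k (fun y => \sum_(i <- r | P i) v i y) x =
  \sum_(i <- r | P i) kint k (v i) x.
Proof.
move=> Dx bv; rewrite /kint; under eq_Rintegral do rewrite mulr_sumr.
apply: Rintegral_sum => i; apply: bmeas_integrable.
by apply: bmeasM => //; exact: psdk_row.
Qed.

Lemma kintB v w x : D x -> bmeas v -> bmeas w ->
  kint k (fun y => v y - w y) x = kint k v x - kint k w x.
Proof.
move=> Dx bv bw; rewrite /kint; under eq_Rintegral do rewrite mulrBr.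
by apply: RintegralB => //; apply: bmeas_integrable;
  apply: bmeasM => //; exact: psdk_row.
Qed.

Lemma kform_integrable u v : bmeas u -> bmeas v ->
  mu.-integrable D (EFin \o (fun x => u x * kint k v x)).
Proof.
by move=> bu bv; apply: bmeas_integrable; apply: bmeasM => //; exact: kint_bmeas.
Qed.

Lemma kform_sumr (I : Type) (r : seq I) (P : pred I) (v : I -> T -> R) u :
  bmeas u -> (forall i, bmeas (v i)) ->
  kform k u (fun y => \sum_(i <- r | P i) v i y) =
  \sum_(i <- r | P i) kform k u (v i).
Proof.
move=> bu bv; rewrite /kform -Rintegral_sum; last by move=> i; exact: kform_integrable.
by apply: eq_Rintegral => x; rewrite inE => Dx; rewrite kint_sum// mulr_sumr.
Qed.

Lemma kformBr u v w : bmeas u -> bmeas v -> bmeas w ->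
  kform k u (fun y => v y - w y) = kform k u v - kform k u w.
Proof.
move=> bu bv bw; rewrite /kform -RintegralB//; try exact: kform_integrable.
by apply: eq_Rintegral => x; rewrite inE => Dx; rewrite kintB// mulrBr.
Qed.

Lemma kformBl u v w : bmeas u -> bmeas v -> bmeas w ->
  kform k (fun y => u y - v y) w = kform k u w - kform k v w.
Proof.
move=> bu bv bw; rewrite /kform -RintegralB//; try exact: kform_integrable.
by apply: eq_Rintegral => x _; rewrite mulrBl.
Qed.

Lemma kform_suml (I : Type) (r : seq I) (P : pred I) (u : I -> T -> R) v :
  (forall i, bmeas (u i)) -> bmeas v ->
  kform k (fun y => \sum_(i <- r | P i) u i y) v =
  \sum_(i <- r | P i) kform k (u i) v.
Proof.
move=> bu bv; rewrite /kform -Rintegral_sum; last by move=> i; exact: kform_integrable.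
by apply: eq_Rintegral => x _; rewrite mulr_suml.
Qed.

(** Expansion of $Q(u-v,u-v)\ge0$, the two cross terms being equal by symmetry. *)
Lemma kform_polar u v : bmeas u -> bmeas v ->
  2 * kform k u v <= kform k u u + kform k v v.
Proof.
move=> bu bv; have buv := bmeasB _ _ bu bv.
have := psdk_ge0 _ psdk _ buv.
rewrite (kformBr (fun y => u y - v y) u v)// (kformBl u v u)// (kformBl u v v)//.
rewrite (psdk_sym _ psdk v u)//.
by move: (kform k u u) (kform k u v) (kform k v v) => a b c; lra.
Qed.

End OneKernel.

Lemma eq_kform k u u' v v' : (forall x, D x -> u x = u' x) ->
  (forall x, D x -> v x = v' x) -> kform k u v = kform k u' v'.
Proof.
move=> uu' vv'; apply: eq_Rintegral => x; rewrite inE => Dx; rewrite uu'//.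
congr (_ * _); apply: eq_Rintegral => y; rewrite inE => Dy; rewrite vv'//.
Qed.

(** The iterated integral splits into $(\int\phi u)(\int\phi v)$, which is symmetric, and a square
    when $u=v$. *)
Lemma psd_kernel_rank1 phi : bmeas phi -> psd_kernel (fun x y => phi x * phi y).
Proof.
move=> bphi.
have kintE v x : bmeas v -> kint (fun x y => phi x * phi y) v x =
    phi x * \int[mu]_(y in D) (phi y * v y).
  move=> bv; rewrite /kint -RintegralZl//; last exact/bmeas_integrable/bmeasM.
  by apply: eq_Rintegral => y _; rewrite mulrA.
have kformE u v : bmeas u -> bmeas v -> kform (fun x y => phi x * phi y) u v =
    (\int[mu]_(y in D) (phi y * u y)) * \int[mu]_(y in D) (phi y * v y).
  move=> bu bv; set J := (X in _ = _ * X).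
  transitivity (\int[mu]_(x in D) (phi x * u x * J)).
    by apply: eq_Rintegral => x _; rewrite kintE// mulrCA mulrA.
  by apply: RintegralZr => //; exact/bmeas_integrable/bmeasM.
split.
- case: bphi => [_ [C pC]]; exists (C * C) => x y Dx Dy.
  by rewrite normrM ler_pM ?pC.
- by move=> x Dx; case: (bmeasM _ _ (bmeas_cst (phi x)) bphi).
- move=> v bv; rewrite (_ : kint _ v =
      fun x => phi x * \int[mu]_(y in D) (phi y * v y)); last first.
    by apply/funext => x; rewrite kintE.
  by case: (bmeasM _ _ bphi (bmeas_cst (\int[mu]_(y in D) (phi y * v y)))).
- by move=> u v bu bv; rewrite !kformE// mulrC.
- by move=> u bu; rewrite kformE// -expr2 sqr_ge0.
Qed.

Lemma psd_kernelZ c k : 0 <= c -> psd_kernel k ->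
  psd_kernel (fun x y => c * k x y).
Proof.
move=> c0 pk.
have kintE v x : bmeas v -> D x -> kint (fun x y => c * k x y) v x = c * kint k v x.
  move=> bv Dx; rewrite /kint -RintegralZl//; last exact/bmeas_integrable/bmeasM/bv/psdk_row.
  by apply: eq_Rintegral => y _; rewrite mulrA.
have kformE u v : bmeas u -> bmeas v ->
    kform (fun x y => c * k x y) u v = c * kform k u v.
  move=> bu bv; rewrite /kform -RintegralZl//; last exact: kform_integrable.
  by apply: eq_Rintegral => x; rewrite inE => Dx; rewrite kintE// mulrCA.
split.
- have [C kC] := psdk_bound _ pk; exists (c * C) => x y Dx Dy.
  by rewrite normrM ger0_norm// ler_wpM2l// kC.
- by move=> x Dx; case: (bmeasM _ _ (bmeas_cst c) (psdk_row _ pk _ Dx)).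
- move=> v bv; apply: (eq_measurable_fun (fun x => c * kint k v x)).
    by move=> x; rewrite inE => Dx; rewrite kintE.
  by case: (bmeasM _ _ (bmeas_cst c) (kint_bmeas _ pk _ bv)).
- move=> u v bu bv.
  by rewrite (kformE _ _ bu bv) (kformE _ _ bv bu) (psdk_sym _ pk _ _ bu bv).
- by move=> u bu; rewrite kformE// mulr_ge0// psdk_ge0.
Qed.

Lemma psd_kernelD k l : psd_kernel k -> psd_kernel l ->
  psd_kernel (fun x y => k x y + l x y).
Proof.
move=> pk pl.
have kintE v x : bmeas v -> D x ->
    kint (fun x y => k x y + l x y) v x = kint k v x + kint l v x.
  move=> bv Dx; rewrite /kint -RintegralD//; last 2 first.
  - exact/bmeas_integrable/bmeasM/bv/psdk_row.
  - exact/bmeas_integrable/bmeasM/bv/psdk_row.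
  by apply: eq_Rintegral => y _; rewrite mulrDl.
have kformE u v : bmeas u -> bmeas v ->
    kform (fun x y => k x y + l x y) u v = kform k u v + kform l u v.
  move=> bu bv; rewrite /kform -RintegralD//; try exact: kform_integrable.
  by apply: eq_Rintegral => x; rewrite inE => Dx; rewrite kintE// mulrDr.
split.
- have [C kC] := psdk_bound _ pk; have [E lE] := psdk_bound _ pl.
  exists (C + E) => x y Dx Dy.
  by rewrite (le_trans (ler_normD _ _))// lerD ?kC ?lE.
- by move=> x Dx; case: (bmeasD _ _ (psdk_row _ pk _ Dx) (psdk_row _ pl _ Dx)).
- move=> v bv; apply: (eq_measurable_fun (fun x => kint k v x + kint l v x)).
    by move=> x; rewrite inE => Dx; rewrite kintE.
  by case: (bmeasD _ _ (kint_bmeas _ pk _ bv) (kint_bmeas _ pl _ bv)).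
- move=> u v bu bv; rewrite (kformE _ _ bu bv) (kformE _ _ bv bu).
  by rewrite (psdk_sym _ pk _ _ bu bv) (psdk_sym _ pl _ _ bu bv).
- by move=> u bu; rewrite kformE// addr_ge0// psdk_ge0.
Qed.

Lemma psd_kernel_sum (I : Type) (r : seq I) (k : I -> T -> T -> R) :
  (forall i, psd_kernel (k i)) ->
  psd_kernel (fun x y => \sum_(i <- r) k i x y).
Proof.
move=> pk; elim: r => [|i r IH].
  (* The empty sum is the zero kernel, of rank-one form with $\phi=0$. *)
  have -> : (fun x y => \sum_(i <- [::]) k i x y) = (fun x y => 0 * 0 : R).
    by apply/funext => x; apply/funext => y; rewrite big_nil mul0r.
  exact: psd_kernel_rank1 (bmeas_cst 0).
have -> : (fun x y => \sum_(j <- i :: r) k j x y) =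
    (fun x y => k i x y + \sum_(j <- r) k j x y).
  by apply/funext => x; apply/funext => y; rewrite big_cons.
exact: psd_kernelD.
Qed.

(** Dominated convergence is applied twice, to the inner integral at fixed [x] and then to the outer
    one; symmetry and positivity pass to the limit. *)
Lemma psd_kernel_lim (k_ : nat -> T -> T -> R) (k : T -> T -> R) C :
  (forall m, psd_kernel (k_ m)) ->
  (forall m x y, D x -> D y -> `|k_ m x y| <= C) ->
  (forall x y, D x -> D y -> k_ m x y @[m --> \oo] --> k x y) ->
  psd_kernel k.
Proof.
move=> pk kC ck.
have kintc v x : bmeas v -> D x -> kint (k_ m) v x @[m --> \oo] --> kint k v x.
  move=> [mv [E vE]] Dx; apply: (@cvg_Rintegral_bounded _ _ (C * E)).
  - by move=> m; apply: measurable_funM => //; exact: psdk_measurable.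
  - by move=> m y Dy; rewrite normrM ler_pM ?kC ?vE.
  - by move=> y Dy; apply: cvgMr_tmp; exact: ck.
have kformc u v : bmeas u -> bmeas v -> kform (k_ m) u v @[m --> \oo] --> kform k u v.
  move=> [mu_ [B uB]] [mv [E vE]].
  apply: (@cvg_Rintegral_bounded _ _ (B * (C * E * fine (mu D)))).
  - move=> m; apply: measurable_funM => //.
    by apply: psdk_kint => //; split => //; exists E.
  - move=> m x Dx; rewrite normrM ler_pM ?uB//.
    exact: kint_bound (kC m) (psdk_measurable _ (pk m)) mv vE x Dx.
  - by move=> x Dx; apply: cvgMl_tmp; apply: kintc => //; split => //; exists E.
split.
- exists C => x y Dx Dy.
  have := ck x y Dx Dy => /cvg_norm h.
  rewrite -(cvg_lim _ h)//; apply: limr_le; first by apply/cvg_ex; eexists; exact: h.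
  by apply: nearW => m; exact: kC.
- move=> x Dx; apply: (@measurable_fun_cvg _ _ _ _ (fun m => k_ m x)).
    by move=> m; exact: psdk_measurable.
  by move=> y; exact: ck.
- move=> v bv; apply: (@measurable_fun_cvg _ _ _ _ (fun m => kint (k_ m) v)).
    by move=> m; exact: psdk_kint.
  by move=> y; exact: kintc.
- move=> u v bu bv; apply: (cvg_unique _ (kformc u v bu bv)) => //.
  rewrite (_ : (fun m => _) = (fun m => kform (k_ m) v u)); first exact: kformc.
  by apply/funext => m; rewrite (psdk_sym _ (pk m) u v).
- move=> u bu; have h := kformc u u bu bu.
  rewrite -(cvg_lim _ h)//; apply: limr_ge; first by apply/cvg_ex; eexists; exact: h.
  by apply: nearW => m; exact: psdk_ge0.
Qed.

End PsdKernel.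

(** * The one-dimensional theta function *)

Section Theta.
Context {R : realType}.
Variable tau : R.
Hypothesis tau_gt0 : 0 < tau.

(** Gaussian without normalization; the factor $(4\pi\tau)^{-1}$ of the planar kernel reappears in
    [heatGE]. *)
Definition bump1 (s : R) : R := expR (- s ^+ 2 / (4 * tau)).

Definition theta_psum (j : nat) (s : R) : R :=
  bump1 s + \sum_(k < j) (bump1 (s + 2 * pi * k.+1%:R) + bump1 (s - 2 * pi * k.+1%:R)).

(** Convergence is proved for $|s|\le2\pi$, which covers the coordinate differences of points of the
    fundamental domain. *)
Definition theta (s : R) : R := limn (theta_psum ^~ s).

Lemma bump1_ge0 s : 0 <= bump1 s. Proof. exact: expR_ge0. Qed.

Lemma bump1_le1 s : bump1 s <= 1.
Proof.
by rewrite -expR0 ler_expR mulNr oppr_le0 divr_ge0 ?sqr_ge0// mulr_ge0// ltW.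
Qed.

(** From $e^y\ge1+y$ the Gaussian is at most $4\tau/(4\tau+k^2)$, and $(k+1)(k+2)\le4(1+k^2)$
    compares this with a difference that telescopes under summation. *)
Lemma bump1_tail s (k : nat) : k%:R <= `|s| ->
  bump1 s <= 4 * (1 + 4 * tau) * (k.+1%:R^-1 - k.+2%:R^-1).
Proof.
move=> ks; set z : R := k%:R; have z0 : 0 <= z by rewrite /z.
have t4 : 0 < 4 * tau by rewrite mulr_gt0.
have zs : z ^+ 2 <= s ^+ 2 by rewrite -(real_normK (num_real s)) ler_sqr ?nnegrE.
apply: (@le_trans _ _ (1 + z ^+ 2 / (4 * tau))^-1).
  rewrite /bump1 mulNr expRN lef_pV2 ?posrE ?expR_gt0//; last first.
    by rewrite ltr_pwDl// divr_ge0 ?sqr_ge0// ltW.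
  apply: le_trans (expR_ge1Dx _).
  by rewrite lerD2l ler_pM2r ?invr_gt0.
have -> : k.+1%:R = z + 1 :> R by rewrite -natr1.
have -> : k.+2%:R = z + 2 :> R by rewrite -!natr1 -/z; ring.
have z1 : z + 1 != 0 by rewrite gt_eqF// ltr_wpDl.
have z2 : z + 2 != 0 by rewrite gt_eqF// ltr_wpDl.
have -> : (1 + z ^+ 2 / (4 * tau))^-1 = 4 * tau / (4 * tau + z ^+ 2).
  by field; rewrite !gt_eqF// ltr_pwDl// ?sqr_ge0 //.
have -> : 4 * (1 + 4 * tau) * ((z + 1)^-1 - (z + 2)^-1) =
    4 * (1 + 4 * tau) / ((z + 1) * (z + 2)) by field; rewrite ?z1 ?z2.
rewrite ler_pdivrMr; last by rewrite ltr_pwDl// sqr_ge0.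
rewrite mulrAC ler_pdivlMr; last by rewrite mulr_gt0// ltr_wpDl.
have h : (z + 1) * (z + 2) <= 4 * (1 + z ^+ 2) by nra.
by have := sqr_ge0 z; move: h t4; move: (4 * tau) => c; nra.
Qed.

Lemma theta_psum_nd s : nondecreasing_seq (theta_psum ^~ s).
Proof.
apply/nondecreasing_seqP => j; rewrite /theta_psum big_ord_recr/= addrA lerDl.
by rewrite addr_ge0// bump1_ge0.
Qed.

(** The central term contributes at most 1 and each of the two telescoping tails at most
    $4(1+4\tau)$. *)
Definition theta_bound : R := 1 + 8 * (1 + 4 * tau).

Lemma theta_psum_le j s : `|s| <= 2 * pi -> theta_psum j s <= theta_bound.
Proof.
move=> s2; have p2 := pi_ge2 R.
rewrite lerD ?bump1_le1//.
apply: (@le_trans _ _ (\sum_(k < j) 8 * (1 + 4 * tau) * (k.+1%:R^-1 - k.+2%:R^-1))).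
  apply: ler_sum => k _.
  (* As $|s|\le2\pi$, a shift by $\pm2\pi(k+1)$ leaves a distance of at least $2\pi k\ge k$ from 0,
     as the tail estimate requires. *)
  have kp : k%:R <= 2 * pi * k%:R :> R by rewrite ler_peMl//; lra.
  have h : k%:R + `|s| <= 2 * pi * k.+1%:R by rewrite -natr1; lra.
  have [h1 h2] : k%:R <= `|s + 2 * pi * k.+1%:R| /\ k%:R <= `|s - 2 * pi * k.+1%:R|.
    move: (2 * pi * k.+1%:R) h => w h.
    split.
      by apply: le_trans (ler_norm _); have := ler_norm (- s); rewrite normrN; lra.
    by rewrite distrC; apply: le_trans (ler_norm _); have := ler_norm s; lra.
  have -> : 8 * (1 + 4 * tau) = 4 * (1 + 4 * tau) + 4 * (1 + 4 * tau) by ring.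
  by rewrite [leRHS]mulrDl lerD// bump1_tail.
rewrite -mulr_sumr.
have -> : \sum_(k < j) (k.+1%:R^-1 - k.+2%:R^-1) = 1 - j.+1%:R^-1 :> R.
  elim: j => [|j IH]; first by rewrite big_ord0 invr1 subrr.
  by rewrite big_ord_recr/= IH addrA subrK.
by apply: ler_piMr; [have := tau_gt0; lra|rewrite gerBl invr_ge0].
Qed.

Lemma theta_psum_cvg s : `|s| <= 2 * pi -> theta_psum j s @[j --> \oo] --> theta s.
Proof.
move=> s2; apply: nondecreasing_is_cvgn; first exact: theta_psum_nd.
by exists theta_bound => _ [j _ <-]; exact: theta_psum_le.
Qed.

(* The row and the column added to the index square make up one symmetric
   partial sum; this turns Cesaro means into sums over differences [a - b]. *)
Lemma sum_square_bump1 N s :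
  \sum_(a < N) \sum_(b < N) bump1 (s + 2 * pi * a%:R - 2 * pi * b%:R) =
  \sum_(j < N) theta_psum j s.
Proof.
elim: N => [|N IH]; first by rewrite !big_ord0.
rewrite [RHS]big_ord_recr/= -IH.
under eq_bigr do rewrite big_ord_recr/=.
rewrite big_split/= big_ord_recr/= -addrA; congr (_ + _).
rewrite [X in _ + X]big_ord_recr/= addrK addrA addrC /theta_psum; congr (_ + _).
rewrite big_split/=; congr (_ + _); rewrite [LHS](reindex_inj rev_ord_inj)/=.
  apply: eq_bigr => i _; congr bump1; rewrite natrB ?ltn_ord//; ring.
apply: eq_bigr => i _; congr bump1; rewrite natrB ?ltn_ord//; ring.
Qed.

(** Shifting [s] and [t] separately makes every term a function $g(p-q)$ of one point per variable,
    the form in which positivity can be read off. *)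
Definition cesaro_ker (N : nat) (s t : R) : R :=
  N.+1%:R^-1 *
  \sum_(a < N.+1) \sum_(b < N.+1) bump1 ((s + 2 * pi * a%:R) - (t + 2 * pi * b%:R)).

Lemma cesaro_kerE N s t :
  cesaro_ker N s t = N.+1%:R^-1 * \sum_(j < N.+1) theta_psum j (s - t).
Proof.
rewrite -sum_square_bump1; congr (_ * _).
by apply: eq_bigr => a _; apply: eq_bigr => b _; congr bump1; ring.
Qed.

Lemma cesaro_ker_cvg s t : `|s - t| <= 2 * pi ->
  cesaro_ker N s t @[N --> \oo] --> theta (s - t).
Proof.
move=> st; have := cesaro (theta_psum_cvg _ st).
rewrite /arithmetic_mean; apply: cvg_trans.
apply: near_eq_cvg; apply: nearW => N.
by rewrite cesaro_kerE /= seriesEord.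
Qed.

Lemma cesaro_ker_le N s t : `|s - t| <= 2 * pi -> cesaro_ker N s t <= theta_bound.
Proof.
move=> st; rewrite cesaro_kerE ler_pdivrMl//.
apply: (@le_trans _ _ (\sum_(j < N.+1) theta_bound)).
  by apply: ler_sum => j _; exact: theta_psum_le.
by rewrite sumr_const card_ord mulr_natl.
Qed.

(** One-variable factor of the [k]-th Taylor term: the sum of $g(p)p^k$ over the shifts $p=s+2\pi
    a$. *)
Definition moment (N k : nat) (s : R) : R :=
  \sum_(a < N.+1) bump1 (s + 2 * pi * a%:R) * (s + 2 * pi * a%:R) ^+ k.

(** Coefficient of $(pq)^k$ in $\exp(pq/(2\tau))$, divided by the number of shifts. *)
Definition taylor_coef (N k : nat) : R := N.+1%:R^-1 * (k`!%:R * (2 * tau) ^+ k)^-1.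

Definition taylor_ker (N M : nat) (s t : R) : R :=
  \sum_(k < M) taylor_coef N k * (moment N k s * moment N k t).

Lemma taylor_coef_ge0 N k : 0 <= taylor_coef N k.
Proof.
by rewrite mulr_ge0 ?invr_ge0// mulr_ge0 ?exprn_ge0// mulr_ge0// ltW.
Qed.

Lemma bump1B p q : bump1 (p - q) = bump1 p * bump1 q * expR (p * q / (2 * tau)).
Proof.
by rewrite /bump1 -!expRD; congr expR; field; rewrite gt_eqF.
Qed.

Lemma taylor_kerE N M s t : taylor_ker N M s t = N.+1%:R^-1 *
  \sum_(a < N.+1) \sum_(b < N.+1)
    bump1 (s + 2 * pi * a%:R) * bump1 (t + 2 * pi * b%:R) *
    series (exp_coeff ((s + 2 * pi * a%:R) * (t + 2 * pi * b%:R) / (2 * tau))) M.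
Proof.
under [in RHS]eq_bigr do under eq_bigr do rewrite seriesEord mulr_sumr.
under [in RHS]eq_bigr do rewrite exchange_big/=.
rewrite exchange_big/= mulr_sumr; apply: eq_bigr => k _.
rewrite /taylor_coef /moment -mulrA; congr (_ * _).
rewrite big_distrlr/= mulr_sumr; apply: eq_bigr => a _.
rewrite mulr_sumr; apply: eq_bigr => b _.
rewrite /exp_coeff/= expr_div_n !exprMn invfM.
move: (k`!%:R^-1) (2 ^+ k * tau ^+ k)^-1 ((s + _) ^+ k) ((t + _) ^+ k) => c e x y.
by ring.
Qed.

Lemma taylor_ker_cvg N s t : taylor_ker N M s t @[M --> \oo] --> cesaro_ker N s t.
Proof.
under eq_fun do rewrite taylor_kerE.
apply: cvgMl_tmp.
apply: cvg_big => [x y|a _]; first exact: add_continuous.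
apply: cvg_big => [x y|b _]; first exact: add_continuous.
rewrite bump1B; apply: cvgMl_tmp; exact: is_cvg_series_exp_coeff.
Qed.

(** For nonnegative [s] and [t] all shifted points are nonnegative, so every Taylor term is
    nonnegative and the truncations increase to their limit. This gives a bound uniform in [M]. *)
Lemma taylor_ker_itv N M s t : 0 <= s -> 0 <= t ->
  0 <= taylor_ker N M s t <= cesaro_ker N s t.
Proof.
move=> s0 t0; rewrite taylor_kerE.
have sh (x : R) (a : nat) : 0 <= x -> 0 <= x + 2 * pi * a%:R.
  by move=> x0; rewrite addr_ge0// !mulr_ge0// pi_ge0.
have e0 (a b : nat) i : 0 <= exp_coeff ((s + 2 * pi * a%:R) * (t + 2 * pi * b%:R) / (2 * tau)) i.
  by apply: exp_coeff_ge0; rewrite divr_ge0 ?mulr_ge0 ?sh// ltW.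
apply/andP; split.
  rewrite mulr_ge0 ?invr_ge0//; apply: sumr_ge0 => a _; apply: sumr_ge0 => b _.
  rewrite !mulr_ge0 ?bump1_ge0// seriesEord; apply: sumr_ge0 => i _; exact: e0.
rewrite ler_wpM2l ?invr_ge0//; apply: ler_sum => a _; apply: ler_sum => b _.
rewrite bump1B ler_wpM2l ?mulr_ge0 ?bump1_ge0//.
apply: nondecreasing_cvgn_le; last exact: is_cvg_series_exp_coeff.
apply/nondecreasing_seqP => i; rewrite !seriesEord/= big_ord_recr/= lerDl; exact: e0.
Qed.

End Theta.

(** * The heat kernel on the torus *)

Local Notation mu2 := ((@lebesgue_measure _) \x (@lebesgue_measure _))%E.

Section HeatKernel.
Context {R : realType}.

(** Any finite set of indices lies in some [r j], so the supremum over finite sets is the limit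
    along the increasing lists. *)
Lemma esum_exhaustion (T : choiceType) (a : T -> R) (r : nat -> seq T) (l : R) :
  (forall x, 0 <= a x) -> (forall j, uniq (r j)) ->
  (forall i j, (i <= j)%N -> {subset r i <= r j}) ->
  (forall x, exists j, x \in r j) ->
  \sum_(x <- r j) a x @[j --> \oo] --> l ->
  (\esum_(x in [set: T]) (a x)%:E = l%:E)%E.
Proof.
move=> a0 ur rmono rcov cl.
have clE : (\sum_(x <- r j) (a x)%:E)%E @[j --> \oo] --> l%:E.
  under eq_fun do rewrite sumEFin.
  by apply: cvg_EFin; [exact: nearW|exact: cl].
have sub (A B : set T) : finite_set A -> finite_set B -> A `<=` B ->
    (\sum_(x \in A) (a x)%:E <= \sum_(x \in B) (a x)%:E)%E.
  move=> fA fB AB; apply: lee_fsum_nneg_subset => //; first exact/subsetP.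
  by move=> x _; rewrite lee_fin.
have rE j : (\sum_(x <- r j) (a x)%:E = \sum_(x \in [set` r j]) (a x)%:E)%E.
  by rewrite fsbig_seq.
have rnd : {homo (fun j => (\sum_(x <- r j) (a x)%:E)%E) : i j / (i <= j)%N >-> (i <= j)%E}.
  by move=> i j ij; rewrite !rE; apply: sub => // x; exact: rmono.
apply/eqP; rewrite eq_le; apply/andP; split.
  apply: ge_ereal_sup => /= _ [A [fA _] <-].
  have [f fP] := choice rcov.
  (* By stage [j] every element of the finite set [A] has appeared. *)
  pose j := \max_(x <- finmap.enum_fset (fset_set A)) f x.
  apply: (@le_trans _ _ (\sum_(x <- r j) (a x)%:E)%E).
    rewrite rE; apply: sub => // x Ax /=.
    apply: rmono (fP x); rewrite /j; apply: leq_bigmax_seq => //.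
    by rewrite in_fset_set// inE.
  rewrite -(cvg_lim _ clE)//; apply: lime_ge; first by apply/cvg_ex; exists l%:E.
  by exists j => // i /= ji; exact: rnd.
rewrite -(cvg_lim _ clE)//; apply: lime_le; first by apply/cvg_ex; exists l%:E.
apply: nearW => j; apply: esum_ge; exists [set` r j]; last by rewrite rE.
by split.
Qed.

(** [Negz k] is $-(k+1)$, so both lists run over absolute values $1,\dots,j$, matching the pairs of
    terms in [theta_psum]. *)
Definition sym_ints (j : nat) : seq int :=
  0%Z :: [seq Posz k.+1 | k <- iota 0 j] ++ [seq Negz k | k <- iota 0 j].

Lemma mem_sym_ints j (m : int) : (m \in sym_ints j) = (`|m| <= j)%N.
Proof.
rewrite inE mem_cat; case: m => [[|k]|k] //=.
- rewrite mem_map; last by move=> x y [].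
  rewrite mem_iota add0n [X in _ || X](_ : _ = false) ?orbF//.
  by apply/negbTE/mapP => -[].
- rewrite mem_map; last by move=> x y [].
  rewrite mem_iota add0n [X in X || _](_ : _ = false)//.
  by apply/negbTE/mapP => -[].
Qed.

Lemma sym_ints_uniq j : uniq (sym_ints j).
Proof.
rewrite /= cat_uniq mem_cat negb_or !map_inj_uniq ?iota_uniq//=; try by move=> x y [].
rewrite andbT -andbA; apply/and3P; split; try by apply/mapP => -[].
by apply/hasPn => _ /mapP[k _ ->]; apply/mapP => -[].
Qed.

Variable tau : R.
Hypothesis tau_gt0 : 0 < tau.

Lemma sum_sym_ints j s :
  \sum_(m <- sym_ints j) bump1 tau (s + 2 * pi * m%:~R) = theta_psum tau j s.
Proof.
rewrite big_cons big_cat !big_map/= mulr0 addr0 /theta_psum -(big_mkord xpredT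
  (fun k => bump1 tau (s + 2 * pi * k.+1%:R) + bump1 tau (s - 2 * pi * k.+1%:R))).
rewrite /index_iota subn0 big_split/=; congr (_ + (_ + _)).
by apply: eq_bigr => k _; rewrite NegzE mulrNz mulrN.
Qed.

(** The lattice is exhausted by square boxes; the planar Gaussian factors, so each box sum is a
    product of two symmetric partial sums. *)
Lemma heatGE s t : `|s| <= 2 * pi -> `|t| <= 2 * pi ->
  heatG tau (s, t) = (4 * pi * tau)^-1 * (theta tau s * theta tau t).
Proof.
move=> s2 t2; rewrite /heatG/=.
pose box j := [seq (x, y) | x <- sym_ints j, y <- sym_ints j].
have boxP j (m : int * int) : (m \in box j) = (`|m.1| <= j)%N && (`|m.2| <= j)%N.
  rewrite -!mem_sym_ints; apply/allpairsP/andP => [[p [p1 p2 ->]]//|[m1 m2]].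
  by exists m; split => //; case: (m).
rewrite (@esum_exhaustion _ _ box
  ((4 * pi * tau)^-1 * (theta tau s * theta tau t)))//.
- by move=> x; rewrite mulr_ge0 ?expR_ge0// invr_ge0 !mulr_ge0 ?pi_ge0// ltW.
- by move=> j; apply: allpairs_uniq; try exact: sym_ints_uniq;
    move=> [? ?] [? ?] _ _ [-> ->].
- by move=> i j ij m; rewrite !boxP => /andP[m1 m2]; rewrite !(leq_trans _ ij).
- by move=> m; exists (maxn `|m.1| `|m.2|)%N; rewrite boxP leq_maxl leq_maxr.
rewrite [X in X x @[x --> _] --> _](_ : _ = (fun j =>
    (4 * pi * tau)^-1 * (theta_psum tau j s * theta_psum tau j t))); last first.
  apply/funext => j.
  rewrite big_allpairs -!sum_sym_ints big_distrlr/= mulr_sumr.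
  apply: eq_bigr => x _; rewrite mulr_sumr; apply: eq_bigr => y _.
  by rewrite /gauss/bump1/= -expRD; congr (_ * expR _); rewrite -mulrDl opprD.
by apply: cvgMl_tmp; apply: cvgM; exact: theta_psum_cvg.
Qed.

Lemma Omega_DE : @Omega_D R = `[0, 2 * pi[%classic `*` `[0, 2 * pi[%classic.
Proof. by apply/seteqP; split => -[x y]; rewrite /Omega_D/= !in_itv. Qed.

Lemma measurable_Omega_D : measurable (@Omega_D R).
Proof. by rewrite Omega_DE; apply: measurableX. Qed.

Lemma leb2_Omega_D : (leb2 (@Omega_D R) < +oo)%E.
Proof.
rewrite /leb2 Omega_DE product_measure1E//= lebesgue_measure_itv/=.
by case: ifP => _; rewrite -?EFinB -?EFinM ?mule0 ltry.
Qed.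

Lemma moment_bmeas N k l :
  bmeas (@Omega_D R) (fun x : R * R => moment tau N k x.1 * moment tau N l x.2).
Proof.
have H (g : R * R -> R) i : measurable_fun setT g ->
    (forall x, Omega_D x -> 0 <= g x <= 2 * pi) ->
    bmeas (@Omega_D R) (fun x => moment tau N i (g x)).
  move=> mg gb; apply: bmeas_sum => a.
  have ms : measurable_fun setT (fun x => g x + 2 * pi * a%:R).
    by apply: measurable_funD.
  apply: bmeasM.
    split.
      apply: measurable_funTS; apply: (measurableT_comp (@measurable_expR R)).
      apply: measurable_funM => //; apply: measurable_funN.
      exact: measurable_funX.
    by exists 1 => x _; rewrite ger0_norm ?bump1_ge0// bump1_le1.
  split; first by apply: measurable_funTS; exact: measurable_funX.
  (* The coordinate lies in $[0,2\pi]$, so the shifted power is at most its value at $2\pi$. *)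
  exists ((2 * pi + 2 * pi * a%:R) ^+ i) => x /gb/andP[g0 g2].
  have p0 : 0 <= 2 * pi * a%:R :> R by rewrite !mulr_ge0 ?pi_ge0.
  rewrite normrX ger0_norm ?addr_ge0//; apply: lerXn2r; rewrite ?nnegrE.
  - exact: addr_ge0.
  - by rewrite addr_ge0// (le_trans g0).
  - by rewrite lerD2r.
apply: bmeasM; apply: H; try exact: measurable_fst; try exact: measurable_snd.
- by move=> x [/andP[-> /ltW ->]].
- by move=> x [_ /andP[-> /ltW ->]].
Qed.

Lemma Omega_D_dist (x y : R * R) : Omega_D x -> Omega_D y ->
  `|x.1 - y.1| <= 2 * pi /\ `|x.2 - y.2| <= 2 * pi.
Proof.
move=> [/andP[a b] /andP[c e]] [/andP[a' b'] /andP[c' e']].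
by split; rewrite ler_norml; lra.
Qed.

Lemma psd_heatG : psd_kernel mu2 (@Omega_D R)
  (fun x y => heatG tau (x.1 - y.1, x.2 - y.2)).
Proof.
have mO := measurable_Omega_D; have fO := leb2_Omega_D.
pose T2 N M (x y : R * R) := taylor_ker tau N M x.1 y.1 * taylor_ker tau N M x.2 y.2.
pose C2 N (x y : R * R) := cesaro_ker tau N x.1 y.1 * cesaro_ker tau N x.2 y.2.
have T2psd N M : psd_kernel mu2 (@Omega_D R) (T2 N M).
  (* The product of two truncated sums is a double sum of rank-one kernels on the plane with
     nonnegative coefficients. *)
  have -> : T2 N M = fun x y => \sum_(k < M) \sum_(l < M)
      (taylor_coef tau N k * taylor_coef tau N l) *
      ((moment tau N k x.1 * moment tau N l x.2) *
       (moment tau N k y.1 * moment tau N l y.2)).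
    apply/funext => x; apply/funext => y; rewrite /T2 big_distrlr/=.
    by apply: eq_bigr => k _; apply: eq_bigr => l _; ring.
  apply: (psd_kernel_sum mu2 _ mO fO) => k; apply: (psd_kernel_sum mu2 _ mO fO) => l.
  apply: (psd_kernelZ mu2 _ mO fO); first by rewrite mulr_ge0// taylor_coef_ge0.
  exact: (psd_kernel_rank1 mu2 (@Omega_D R) mO fO _ (moment_bmeas N k l)).
have T2b N M x y : Omega_D x -> Omega_D y -> 0 <= T2 N M x y <= C2 N x y.
  move=> [/andP[a _] /andP[b _]] [/andP[a' _] /andP[b' _]].
  have /andP[h1 h2] := taylor_ker_itv _ tau_gt0 N M _ _ a a'.
  have /andP[h3 h4] := taylor_ker_itv _ tau_gt0 N M _ _ b b'.
  by rewrite mulr_ge0// ler_pM.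
have C2b N x y : Omega_D x -> Omega_D y -> 0 <= C2 N x y <= theta_bound tau ^+ 2.
  (* The truncation at $M=0$ already gives nonnegativity of [C2]. *)
  move=> Ox Oy; have /andP[h h'] := T2b N 0%N _ _ Ox Oy.
  rewrite (le_trans h h')/= expr2; have [d1 d2] := Omega_D_dist _ _ Ox Oy.
  case: Ox Oy => [/andP[a _] /andP[b _]] [/andP[a' _] /andP[b' _]].
  have /andP[h1 h2] := taylor_ker_itv _ tau_gt0 N 0 _ _ a a'.
  have /andP[h3 h4] := taylor_ker_itv _ tau_gt0 N 0 _ _ b b'.
  apply: ler_pM; [exact: le_trans h1 h2|exact: le_trans h3 h4| |];
    exact: cesaro_ker_le.
(* The limits $M\to\infty$ and then $N\to\infty$ are dominated by the same constant. *)
have C2psd N : psd_kernel mu2 (@Omega_D R) (C2 N).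
  apply: (psd_kernel_lim mu2 _ mO fO (T2 N) _ (theta_bound tau ^+ 2)) => //.
  - move=> M x y Ox Oy; have /andP[h1 h2] := T2b N M _ _ Ox Oy.
    by rewrite ger0_norm// (le_trans h2)//; have /andP[] := C2b N _ _ Ox Oy.
  - by move=> x y Ox Oy; apply: cvgM; exact: taylor_ker_cvg.
have Kpsd : psd_kernel mu2 (@Omega_D R)
    (fun x y => theta tau (x.1 - y.1) * theta tau (x.2 - y.2)).
  apply: (psd_kernel_lim mu2 _ mO fO C2 _ (theta_bound tau ^+ 2)) => //.
  - move=> N x y Ox Oy; have /andP[h1 h2] := C2b N _ _ Ox Oy.
    by rewrite ger0_norm.
  - move=> x y Ox Oy; have [d1 d2] := Omega_D_dist _ _ Ox Oy.
    by apply: cvgM; exact: cesaro_ker_cvg.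
have c0 : 0 <= (4 * pi * tau)^-1 :> R by rewrite invr_ge0 !mulr_ge0 ?pi_ge0// ltW.
have Hpsd := psd_kernelZ mu2 _ mO fO _ _ c0 Kpsd.
have [C KC] := psdk_bound _ _ _ Hpsd.
(* The theta formula for [heatG] is available only for differences of points of [Omega_D]; a
   constant sequence, converging there, transfers positivity. *)
apply: (psd_kernel_lim mu2 _ mO fO (fun=> _) _ C (fun=> Hpsd) (fun=> KC)).
move=> x y Ox Oy; have [d1 d2] := Omega_D_dist _ _ Ox Oy.
by rewrite heatGE//; exact: cvg_cst.
Qed.

End HeatKernel.

(** * Descent for partitions *)

Section Descent.
Context {d : measure_display} {T : measurableType d} {R : realType}.
Variables (mu : {measure set T -> \bar R}) (D : set T).
Hypotheses (mD : measurable D) (finD : (mu D < +oo)%E).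
Variables (k : T -> T -> R) (psdk : psd_kernel mu D k).
Variable n : nat.
Implicit Types u v : 'I_n -> T -> R.

Definition bpartition u : Prop :=
  (forall i, bmeas D (u i)) /\ (forall x, D x -> \sum_(i < n) u i x = 1).

(** Adding the diagonal completes the double sum to $Q(\sum_i u_i,\sum_j v_j)=Q(1,1)$. Two
    partitions are allowed because the linearization mixes old and new phases. *)
Lemma sum_offdiag_kform u v : bpartition u -> bpartition v ->
  \sum_(i < n) \sum_(j < n | j != i) kform mu D k (u i) (v j) =
  kform mu D k (fun=> 1) (fun=> 1) - \sum_(i < n) kform mu D k (u i) (v i).
Proof.
move=> [bu su] [bv sv]; apply/eqP; rewrite eq_sym subr_eq -big_split/=; apply/eqP.
rewrite -(eq_kform mu D k _ _ _ _ su sv) (kform_suml mu D mD finD k psdk)//; last first.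
  exact: bmeas_sum.
apply: eq_bigr => i _; rewrite (kform_sumr mu D mD finD k psdk)//.
by rewrite (bigD1 i)//= addrC.
Qed.

Definition kenergy (c : R) (F u : 'I_n -> T -> R) : R :=
  \sum_(i < n) \int[mu]_(x in D) (u i x * F i x) +
  c * \sum_(i < n) \sum_(j < n | j != i) kform mu D k (u i) (u j).

(** The bracket in [g] is the thresholding function $\phi_i$, the derivative of the energy at [u] in
    the [i]-th phase; symmetry of Q produces the factor 2. *)
Lemma integral_linearized (c : R) (F u v : 'I_n -> T -> R) :
  (forall i, mu.-integrable D (EFin \o F i)) -> bpartition u -> bpartition v ->
  let g x := \sum_(i < n) v i x *
    (F i x + 2 * c * \sum_(j < n | j != i) kint mu D k (u j) x) in
  mu.-integrable D (EFin \o g) /\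
  \int[mu]_(x in D) g x =
  \sum_(i < n) \int[mu]_(x in D) (v i x * F i x) +
  2 * c * (kform mu D k (fun=> 1) (fun=> 1) - \sum_(i < n) kform mu D k (v i) (u i)).
Proof.
move=> iF [bu su] [bv sv] g.
pose h i x := \sum_(j < n | j != i) v i x * kint mu D k (u j) x.
have ivF i : mu.-integrable D (EFin \o (fun x => v i x * F i x)).
  exact: bmeasM_integrable.
have ih i : mu.-integrable D (EFin \o h i).
  apply: bmeas_integrable => //; apply: bmeas_sum => j; apply: bmeasM => //.
  exact: kint_bmeas.
have ich i : mu.-integrable D (EFin \o (fun x => 2 * c * h i x)).
  by apply: (bmeasM_integrable mu D mD (fun=> 2 * c)) => //; exact: bmeas_cst.
have iD i : mu.-integrable D (EFin \o (fun x => v i x * F i x + 2 * c * h i x)).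
  exact: (integrableD mD (ivF i) (ich i)).
have gE : g = fun x => \sum_(i < n) (v i x * F i x + 2 * c * h i x).
  apply/funext => x; apply: eq_bigr => i _.
  by rewrite mulrDr /h -mulr_sumr; congr (_ + _); rewrite mulrCA.
rewrite gE; split.
  apply: (eq_integrable mD (fun x => \sum_(i < n) (v i x * F i x + 2 * c * h i x)%:E)%E).
    by move=> x _; rewrite /= sumEFin.
  by apply: integrable_sum => // i _; exact: iD.
rewrite Rintegral_sum// -sum_offdiag_kform// mulr_sumr -big_split/=.
apply: eq_bigr => i _; rewrite RintegralD//; congr (_ + _).
rewrite RintegralZl//; congr (_ * _); rewrite /h Rintegral_sum// => j.
exact: kform_integrable.
Qed.

(* The kernel is psd, so the interaction energy is concave on partitions and lies
   below its linearization at [u]. *)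
Lemma kenergy_descent (c : R) (F u v : 'I_n -> T -> R) : 0 <= c ->
  (forall i, mu.-integrable D (EFin \o F i)) -> bpartition u -> bpartition v ->
  (forall x, D x ->
    \sum_(i < n) v i x * (F i x + 2 * c * \sum_(j < n | j != i) kint mu D k (u j) x) <=
    \sum_(i < n) u i x * (F i x + 2 * c * \sum_(j < n | j != i) kint mu D k (u j) x)) ->
  kenergy c F v <= kenergy c F u.
Proof.
move=> c0.
(* Here [a], [b], [e] are the diagonal sums of $Q(v_i,u_i)$, $Q(v_i,v_i)$, $Q(u_i,u_i)$, [q] is
   $Q(1,1)$, and [x], [y] are the fidelities of [v] and [u]. *)
have arith (a b e q x y : R) : x + 2 * c * (q - a) <= y + 2 * c * (q - e) ->
    2 * a <= b + e -> x + c * (q - b) <= y + c * (q - e).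
  by move=> h1 h2; have := ler_wpM2l c0 h2; lra.
move=> iF pu pv le_vu.
have [iv Ev] := integral_linearized c F u v iF pu pv.
have [iu Eu] := integral_linearized c F u u iF pu pu.
have le_lin := le_Rintegral mD iv iu le_vu; rewrite Ev Eu in le_lin.
have le_quad : 2 * \sum_(i < n) kform mu D k (v i) (u i) <=
    \sum_(i < n) kform mu D k (v i) (v i) + \sum_(i < n) kform mu D k (u i) (u i).
  rewrite mulr_sumr -big_split/=; apply: ler_sum => i _.
  exact: (kform_polar mu D mD finD k psdk _ _ (pv.1 i) (pu.1 i)).
rewrite /kenergy (sum_offdiag_kform v v pv pv) (sum_offdiag_kform u u pu pu).
exact: arith le_lin le_quad.
Qed.

End Descent.

(** * Thresholding at the first minimizing index *)

Section FirstArgmin.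
Context {R : realType} {n : nat}.
Implicit Types phi : 'I_n -> R * R -> R.

(** Some minimizer exists because the index set is finite and nonempty; the least index among all
    minimizers is then chosen. *)
Lemma first_argmin_ex phi x : (0 < n)%N -> exists i, first_argmin phi x i.
Proof.
move=> n0; pose i0 := Ordinal n0.
case: (@Order.TotalTheory.arg_minP _ _ _ i0 xpredT (fun i => phi i x) isT) => i1 _ i1min.
pose P i := [forall l, phi i x <= phi l x].
have Pi1 : P i1 by apply/forallP => l; exact: i1min.
case: (@arg_minnP _ i1 P (fun i => val i) Pi1) => i /forallP Pi imin.
exists i; split => // l li; rewrite ltNge; apply/negP => le_li.
have /imin : P l by apply/forallP => m; exact: le_trans (Pi m).
by rewrite leqNgt li.
Qed.

Lemma first_argmin_unique phi x i j :
  first_argmin phi x i -> first_argmin phi x j -> i = j.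
Proof.
move=> [i1 i2] [j1 j2]; apply: val_inj; case: (ltngtP i j) => // ij.
- by have := j2 _ ij; rewrite ltNge i1.
- by have := i2 _ ij; rewrite ltNge j1.
Qed.

(** A conjunction along a list, so that measurability in [x] follows by induction on the list. *)
Definition first_argminb phi x i :=
  all (fun l : 'I_n => (phi i x <= phi l x) && ((l < i)%N ==> (phi i x < phi l x)))
    (enum 'I_n).

Lemma first_argminP phi x i : reflect (first_argmin phi x i) (first_argminb phi x i).
Proof.
apply: (iffP allP) => [h|[h1 h2] l _].
  have hl l : (phi i x <= phi l x) && ((l < i)%N ==> (phi i x < phi l x)).
    by apply: h; rewrite mem_enum.
  by split=> l; have /andP[h1 /implyP] := hl l.
by rewrite h1; apply/implyP => /h2.
Qed.

Lemma measurable_first_argminb phi i : (forall l, measurable_fun (@Omega_D R) (phi l)) ->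
  measurable_fun (@Omega_D R) (fun x => first_argminb phi x i).
Proof.
move=> mphi; rewrite /first_argminb; elim: (enum 'I_n) => [|l r IH] //=.
apply: measurable_and => //; apply: measurable_and.
  exact: measurable_fun_ler.
by case: (l < i)%N => //=; exact: measurable_fun_ltr.
Qed.

Variables (phi v : 'I_n -> R * R -> R).
Hypothesis n_gt0 : (0 < n)%N.
Hypothesis vP : forall i x, @Omega_D R x ->
  (first_argmin phi x i -> v i x = 1) /\ (~ first_argmin phi x i -> v i x = 0).

Lemma sum_first_argmin (g : 'I_n -> R) x i : @Omega_D R x -> first_argmin phi x i ->
  \sum_(j < n) v j x * g j = g i.
Proof.
move=> Ox xi; rewrite (bigD1 i)//= big1; last first.
  move=> j ji; rewrite (vP j x Ox).2 ?mul0r// => xj.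
  by move/eqP: ji; apply; exact: first_argmin_unique xj xi.
by rewrite (vP i x Ox).1// mul1r addr0.
Qed.

Lemma tildeB_first_argmin : (forall l, measurable_fun (@Omega_D R) (phi l)) ->
  tildeB v.
Proof.
move=> mphi; split=> [i|]; last split.
- apply: (eq_measurable_fun (fun x => if first_argminb phi x i then 1 else 0 : R)).
    move=> x; rewrite inE => Ox.
    by case: first_argminP => [/(vP i x Ox).1|/(vP i x Ox).2] ->.
  by apply: measurable_fun_if => //; [exact: measurable_Omega_D|
    exact: measurable_first_argminb].
- move=> i x Ox; case: (pselect (first_argmin phi x i)) => h; [right|left].
    exact: (vP i x Ox).1.
  exact: (vP i x Ox).2.
- move=> x Ox; have [i xi] := first_argmin_ex phi x n_gt0.
  by rewrite -(sum_first_argmin (fun=> 1) x i Ox xi); apply: eq_bigr => j _; rewrite mulr1.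
Qed.

Lemma first_argmin_le (u : 'I_n -> R * R -> R) x : tildeB u -> @Omega_D R x ->
  \sum_(i < n) v i x * phi i x <= \sum_(i < n) u i x * phi i x.
Proof.
move=> [_ [u01 su]] Ox; have [i xi] := first_argmin_ex phi x n_gt0.
(* The left side is the minimum of the $\phi_j(x)$; writing it as $\sum_j u_j(x)$ times this minimum
   reduces the claim to a termwise comparison. *)
rewrite (sum_first_argmin (fun j => phi j x) x i Ox xi) -[leLHS]mul1r -(su x Ox) mulr_suml.
apply: ler_sum => j _; apply: ler_wpM2l; last exact: xi.1.
by case: (u01 j x Ox) => ->.
Qed.

End FirstArgmin.

(** * The torus energy as a kernel energy *)

Section Energy.
Context {R : realType}.

Lemma tmod2_id (x : R * R) : Omega_D x -> tmod2 x = x.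
Proof.
have H (a : R) : 0 <= a < 2 * pi -> tmod a = a.
  move=> /andP[a0 a2]; have p0 : 0 < 2 * pi :> R by rewrite mulr_gt0 ?pi_gt0.
  rewrite /tmod (_ : Num.floor _ = 0) ?mulr0 ?subr0//.
  apply: floor_def; apply/andP; split; first by rewrite divr_ge0// ltW.
  by rewrite add0r ltr_pdivrMr// mul1r.
by case: x => a b [/= /H ha /H hb]; rewrite /tmod2/= ha hb.
Qed.

(** The integration variable stays in the fundamental domain, where reduction modulo $2\pi$ is the
    identity. *)
Lemma tconvE (G v : R * R -> R) x :
  tconv G v x = kint mu2 (@Omega_D R) (fun x y => G (x.1 - y.1, x.2 - y.2)) v x.
Proof. by apply: eq_Rintegral => y; rewrite inE => Oy; rewrite tmod2_id. Qed.

Lemma tildeB_bpartition n (u : 'I_n -> R * R -> R) : tildeB u ->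
  bpartition (@Omega_D R) n u.
Proof.
move=> [mu [u01 su]]; split=> // i; split; first exact: mu.
by exists 1 => x Ox; case: (u01 i x Ox) => ->; rewrite ?normr0 ?normr1.
Qed.

Variable tau : R.
Hypothesis tau_gt0 : 0 < tau.
Let K (x y : R * R) := heatG tau (x.1 - y.1, x.2 - y.2).

(** Bounded phases against integrable fidelities and a bounded kernel make every integral finite, so
    the extended-real energy is a real number. *)
Lemma energyE n lam (F u : 'I_n -> R * R -> R) :
  (forall i, mu2.-integrable (@Omega_D R) (EFin \o F i)) -> tildeB u ->
  energy tau lam F u =
  (kenergy mu2 (@Omega_D R) K n (lam * Num.sqrt (pi / tau)) F u)%:E.
Proof.
move=> iF Bu; have [bu _] := tildeB_bpartition _ _ Bu.
have mO := measurable_Omega_D (R := R); have fO := leb2_Omega_D (R := R).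
have psdK := psd_heatG _ tau_gt0.
rewrite /energy /kenergy [RHS]EFinD [in RHS]EFinM -!sumEFin; congr (_ + _ * _)%E.
  apply: eq_bigr => i _; rewrite /Rintegral fineK//.
  by apply: integrable_fin_num => //; exact: (bmeasM_integrable mu2 _ mO _ _ (bu i) (iF i)).
apply: eq_bigr => i _; rewrite -sumEFin; apply: eq_bigr => j _.
rewrite /kform /Rintegral fineK; last first.
  by apply: integrable_fin_num => //; exact: (kform_integrable mu2 _ mO fO _ psdK _ _ (bu i) (bu j)).
by apply: eq_integral => x _; rewrite tconvE.
Qed.

Lemma measurable_tconv_heatG v : bmeas (@Omega_D R) v ->
  measurable_fun (@Omega_D R) (tconv (heatG tau) v).
Proof.
move=> bv; have [+ _] := kint_bmeas mu2 _ (measurable_Omega_D (R := R))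
  (leb2_Omega_D (R := R)) _ (psd_heatG _ tau_gt0) _ bv.
by congr measurable_fun; apply/funext => x; rewrite tconvE.
Qed.

End Energy.

(** * Energy decay along the iteration *)

Theorem theorem2 (R : realType) (n : nat) (tau lam : R) (f : R * R -> R)
  (S : Type) (F : 'I_n -> (R * R -> R) -> S -> R * R -> R)
  (u : nat -> 'I_n -> R * R -> R) (Theta : nat -> S) :
  (2 <= n)%N -> 0 < tau -> 0 < lam ->
  (forall (i : 'I_n) (th : S),
      measurable_fun (@Omega_D R) (F i f th) /\
      (@leb2 R).-integrable (@Omega_D R) (fun x => (F i f th x)%:E)) ->
  tildeB (u 1%N) ->
  (* step (1): Theta^k minimizes the fidelity term *)
  (forall k, (1 <= k)%N -> forall th : S,
      (fidelity (fun i => F i f (Theta k)) (u k)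
       <= fidelity (fun i => F i f th) (u k))%E) ->
  (* steps (2)-(3) *)
  (forall k, (1 <= k)%N ->
     let phi := fun (i : 'I_n) (x : R * R) =>
       F i f (Theta k) x +
       2 * lam * Num.sqrt (pi / tau) *
         \sum_(j < n | j != i) tconv (heatG tau) (u k j) x in
     forall (i : 'I_n) (x : R * R), @Omega_D R x ->
       (first_argmin phi x i -> u k.+1 i x = 1) /\
       (~ first_argmin phi x i -> u k.+1 i x = 0)) ->
  forall k, (1 <= k)%N ->
    (energy tau lam (fun i => F i f (Theta k.+1)) (u k.+1)
     <= energy tau lam (fun i => F i f (Theta k)) (u k))%E.
Proof.
move=> n2 tau0 lam0 iF B1 step1 step23.
have n0 : (0 < n)%N by exact: leq_trans n2.
pose phi k i x := F i f (Theta k) x + 2 * lam * Num.sqrt (pi / tau) *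
  \sum_(j < n | j != i) tconv (heatG tau) (u k j) x.
(* Being a partition propagates: measurability of the current phases makes each $\phi_i$ measurable,
   hence also the sets selected by thresholding. *)
have Bstep k : (1 <= k)%N -> tildeB (u k) -> tildeB (u k.+1).
  move=> k1 Bk; apply: (tildeB_first_argmin (phi k)) => //; first exact: step23.
  move=> l; apply: measurable_funD; first exact: (iF l (Theta k)).1.
  apply: measurable_funM => //.
  under eq_fun do rewrite big_mkcond/=.
  apply: measurable_sum => j; case: (j != l) => //.
  by apply: measurable_tconv_heatG => //; exact: (tildeB_bpartition _ _ Bk).1.
have Bu k : (1 <= k)%N -> tildeB (u k).
  by elim: k => // -[|k] IH _ //; apply: Bstep => //; exact: IH.
move=> k k1; have Bk := Bu _ k1; have Bk1 := Bstep _ k1 Bk.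
(* The intermediate state pairs the new phases with the old parameters. Passing to the new
   parameters changes the fidelity alone, which step (1) at index $k+1$ minimizes. *)
apply: (@le_trans _ _ (energy tau lam (fun i => F i f (Theta k)) (u k.+1))).
  by apply: leeD2r; exact: step1.
have iFk i := (iF i (Theta k)).2.
rewrite (energyE _ tau0 _ _ _ _ iFk Bk1) (energyE _ tau0 _ _ _ _ iFk Bk) lee_fin.
apply: (kenergy_descent mu2 _ measurable_Omega_D leb2_Omega_D _ (psd_heatG _ tau0)).
- by rewrite mulr_ge0 ?sqrtr_ge0// ltW.
- by move=> i; exact: (iF i _).2.
- exact: tildeB_bpartition.
- exact: tildeB_bpartition.
move=> x Ox.
(* Pointwise minimality of the thresholded phases is exactly the comparison of linearized integrands
   that the descent lemma requires, with $c=\lambda\sqrt{\pi/\tau}$. *)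
have := first_argmin_le (phi k) (u k.+1) n0 (step23 k k1) (u k) x Bk Ox.
rewrite /phi; under eq_bigr do under eq_bigr do rewrite tconvE.
under [in X in _ <= X -> _]eq_bigr do under eq_bigr do rewrite tconvE.
by rewrite !mulrA.
Qed.
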